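(* Let $(F,L,l)$ be an instance of the 2-ASLASAT problem and let $l^*$ be a neutral literal of $(F,L,l)$. Then there is a culprit set of $(F,L\cup\{l^*\},l)$ whose size is at most the size of a smallest culprit set of $(F,L,l)$.
   Context: A literal is a Boolean variable or its negation; $\neg$ denotes negation, and for a set $L$ of literals $\neg L=\{\neg l': l'\in L\}$. $Var(\cdot)$ denotes the set of variables. A 2-CNF formula $F$ is a conjunction of clauses each consisting of exactly two literals (a one-literal clause $(l)$ is written $(l\vee l)$; $(l_1\vee l_2)$ and $(l_2\vee l_1)$ are the same clause), with pairwise distinct clauses; $Clauses(F)$ is its set of clauses and $F\setminus S$ is the formula of clauses of $F$ not in $S$. A set of literals is non-contradictory if it contains no literal and its negation. A satisfying assignment of $F$ is a non-contradictory set $P$ of literals with $Var(P)=Var(F)$ such that each clause of $F$ contains a literal of $P$. $SWRT(F,L)$ means $F$ has a satisfying assignment $P$ with $P\cap \neg L=\emptyset$. An instance of the 2-ASLASAT problem is a triple $(F,L,l)$ with $F$ such a 2-CNF formula, $L$ a non-contradictory set of literals with $SWRT(F,L)$ true, and $l$ a literal with $Var(l)\notin Var(L)$. A culprit set of $(F,L,l)$ is $S\subseteq Clauses(F)$ with $SWRT(F\setminus S,L\cup\{l\})$ true. A walk of $F$ is a nonempty sequence $(C_1,\dots,C_q)$ of (not necessarily distinct) clauses of $F$ where in each entry one literal is designated first and the other second, such that for $i<q$ the second literal of $C_i$ is the negation of the first literal of $C_{i+1}$; it is from the first literal of $C_1$ to the second literal of $C_q$, and from a set $M$ if its first literal lies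 in $M$. A path is a walk whose clauses are pairwise distinct. For a set $M$ of literals and a literal $l_y$, $SepSize(F,M,l_y)$ is the minimum size of a set $SC$ of clauses of $F$ such that $F\setminus SC$ has no path from $M$ to $l_y$. A literal $l^*$ is a neutral literal of $(F,L,l)$ if $(F,L\cup\{l^*\},l)$ is an instance of the 2-ASLASAT problem and $SepSize(F,\neg L,\neg l)=SepSize(F,\neg(L\cup\{l^*\}),\neg l)$. *)

(* Defs.v *)
From HB Require Import structures.
From mathcomp Require Import all_boot.
From mathcomp Require Import boolp.

Set Implicit Arguments.
Unset Strict Implicit.
Unset Printing Implicit Defensive.

Section TwoASLASAT.

Variable V : finType.

(* (v, true) is the variable v, (v, false) its negation. *)
Definition lit : finType := (V * bool)%type.

Definition neg (x : lit) : lit := (x.1, ~~ x.2).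

Definition neg_set (L : {set lit}) : {set lit} := [set neg x | x in L].

Definition vars (L : {set lit}) : {set V} := [set x.1 | x in L].

Definition non_contradictory (L : {set lit}) : bool :=
  [forall x in L, neg x \notin L].

(* The clause (l1 \/ l2) is the set {l1, l2}: this identifies it with          *)
(* (l2 \/ l1), and (l \/ l) is the singleton {l}. A formula is the set of its  *)
(* clauses, so that Clauses(F) is F and removing clauses is set difference.    *)
Definition clause : finType := {set lit}.

Definition formula : finType := {set clause}.

Definition two_cnf (F : formula) : Prop :=
  forall C : clause, C \in F -> exists l1 l2 : lit, C = [set l1; l2].

Definition formula_vars (F : formula) : {set V} := vars (cover F).

Definition satisfying_assignment (F : formula) (P : {set lit}) : bool :=
  [&& non_contradictory P,
      vars P == formula_vars F
    & [forall C in F, [exists x in C, x \in P]]].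

Definition SWRT (F : formula) (L : {set lit}) : bool :=
  [exists P : {set lit},
     satisfying_assignment F P && (P :&: neg_set L == set0)].

Record instance (F : formula) (L : {set lit}) (l : lit) : Prop := Instance {
  instance_two_cnf : two_cnf F;
  instance_non_contradictory : non_contradictory L;
  instance_SWRT : SWRT F L;
  instance_var : l.1 \notin vars L
}.

Definition culprit_set (F : formula) (L : {set lit}) (l : lit) (S : formula) :
    bool :=
  (S \subset F) && SWRT (F :\: S) (L :|: [set l]).

Definition smallest_culprit_set (F : formula) (L : {set lit}) (l : lit)
    (S : formula) : Prop :=
  culprit_set F L l S /\
  forall S' : formula, culprit_set F L l S' -> #|S| <= #|S'|.

(* An entry of a walk is a clause together with the choice of its first and    *)
(* second literal, that is, an ordered pair of literals.                       *)
Definition entry : finType := (lit * lit)%type.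

Definition entry_clause (e : entry) : clause := [set e.1; e.2].

Definition walk (F : formula) (w : seq entry) : bool :=
  [&& w != [::],
      all (fun e => entry_clause e \in F) w
    & sorted (fun e1 e2 : entry => e1.2 == neg e2.1) w].

Definition simple_path (F : formula) (w : seq entry) : bool :=
  walk F w && uniq [seq entry_clause e | e <- w].

Definition has_path (F : formula) (M : {set lit}) (ly : lit) : Prop :=
  exists (e : entry) (w : seq entry),
    [/\ simple_path F (e :: w), e.1 \in M & (last e w).2 = ly].

Definition separator (F : formula) (M : {set lit}) (ly : lit) (SC : formula) :
    bool :=
  (SC \subset F) && ~~ `[< has_path (F :\: SC) M ly >].

(* F is itself a separator, hence a legitimate starting point for arg min.     *)
Definition SepSize (F : formula) (M : {set lit}) (ly : lit) : nat :=
  #|[arg min_(SC < F | separator F M ly SC) #|SC|]|.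

Definition neutral_literal (F : formula) (L : {set lit}) (l ls : lit) : Prop :=
  instance F (L :|: [set ls]) l /\
  SepSize F (neg_set L) (neg l) =
    SepSize F (neg_set (L :|: [set ls])) (neg l).

Lemma separator_full (F : formula) (M : {set lit}) (ly : lit) :
  separator F M ly F.
Proof.
rewrite /separator subxx /=; apply/asboolPn => -[e [w [/andP[/and3P[_ + _] _] _ _]]].
by rewrite setDv /= inE.
Qed.

Lemma SepSizeP (F : formula) (M : {set lit}) (ly : lit) :
  (exists2 SC : formula, separator F M ly SC & #|SC| = SepSize F M ly) /\
  (forall SC : formula, separator F M ly SC -> SepSize F M ly <= #|SC|).
Proof.
rewrite /SepSize; case: arg_minnP; first exact: separator_full.
by move=> SC sepSC minSC; split; first exists SC.
Qed.

Lemma culprit_set_full (F : formula) (L : {set lit}) (l : lit) :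
  culprit_set F L l F.
Proof.
rewrite /culprit_set subxx setDv; apply/existsP; exists set0.
rewrite set0I eqxx andbT; apply/and3P; split.
- by apply/forall_inP => x; rewrite inE.
- by rewrite /formula_vars /vars /cover big_set0.
- by apply/forall_inP => C; rewrite inE.
Qed.

Lemma smallest_culprit_set_exists (F : formula) (L : {set lit}) (l : lit) :
  exists S : formula, smallest_culprit_set F L l S.
Proof.
case: (@arg_minnP _ F (culprit_set F L l) (fun S : formula => #|S|)).
  exact: culprit_set_full.
by move=> S culS minS; exists S.
Qed.

End TwoASLASAT.

(* Main.v *)
Require Import Defs.
From HB Require Import structures.
From mathcomp Require Import all_boot.
From mathcomp Require Import boolp.

(** A clause (a \/ b) is read as the two implications ~a -> b and ~b -> a, so
    that a path from ~L to ~l is a chain of implications from L to ~l.  For a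
    consistent set A of literals let [boundary F A] be the set of clauses along
    which an implication leaves A.  Let A be the set of literals implied by
    L + ls after removal of a minimum separator; neutrality says that its
    boundary is no larger than that of any B containing L and avoiding ~l.
    Given a total assignment P extending L + l, let P' agree with A on the
    variables of A and with P elsewhere.  Clause by clause one checks the
    submodular inequality

      #falsified(P') + #boundary(A & P) <= #falsified(P) + #boundary(A),

    and the boundary of A & P is at least as large as that of A, so P' falsifies
    no more clauses than P.  The clauses falsified by P' are the culprit set. *)

Set Implicit Arguments.
Unset Strict Implicit.
Unset Printing Implicit Defensive.

Section NeutralLiteral.

Variable V : finType.
Implicit Types (x y : lit V) (A B L M P T : {set lit V}) (C : clause V).
Implicit Types (F S : formula V).

(** * Literals, falsified clauses and boundary clauses *)

Lemma negK : involutive (@neg V).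
Proof. by case=> v b; rewrite /neg /= negbK. Qed.

Lemma mem_neg_set L x : (x \in neg_set L) = (neg x \in L).
Proof.
apply/imsetP/idP => [[y yL ->]|nxL]; first by rewrite negK.
by exists (neg x); rewrite ?negK.
Qed.

Lemma same_var x y : x.1 = y.1 -> x = y \/ x = neg y.
Proof.
by case: x y => [v [|]] [w [|]] /= ->; [left | right | right | left].
Qed.

Lemma mem_vars L x : (x.1 \in vars L) = (x \in L) || (neg x \in L).
Proof.
apply/imsetP/orP => [[y yL /same_var[->|->]]|[]].
- by left.
- by right; rewrite negK.
- by move=> xL; exists x.
- by move=> nxL; exists (neg x).
Qed.

Definition total T := forall x, (neg x \in T) = (x \notin T).

Definition falsified F T : formula V := [set C in F | [forall x in C, x \notin T]].

(* Requiring the whole clause to avoid A, instead of only the conclusion of the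
   leaving implication, makes no difference when A is consistent. *)
Definition boundary F A : formula V :=
  [set C in falsified F A | [exists x in C, neg x \in A]].

Lemma mem_falsified F T C a b : C = [set a; b] -> C \in F ->
  (C \in falsified F T) = (a \notin T) && (b \notin T).
Proof.
move=> -> CF; rewrite inE CF /=; apply/forall_inP/andP.
  by move=> H; split; apply: H; rewrite !inE eqxx ?orbT.
by case=> aT bT x /set2P[]->.
Qed.

Lemma mem_boundary F A C a b : C = [set a; b] -> C \in F ->
  (C \in boundary F A) =
  [&& a \notin A, b \notin A & (neg a \in A) || (neg b \in A)].
Proof.
move=> eC CF; rewrite inE (mem_falsified A eC CF) -andbA; congr [&& _, _ & _].
rewrite eC; apply/exists_inP/orP => [[x /set2P[]->]|[]]; first by left.
- by right.
- by exists a; rewrite ?inE ?eqxx.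
- by exists b; rewrite ?inE ?eqxx ?orbT.
Qed.

(** * Total assignments against satisfying assignments *)

Lemma total_of_SWRT F M : non_contradictory M -> SWRT F M ->
  exists T, [/\ total T, M \subset T & falsified F T = set0].
Proof.
move=> /forall_inP ncM /existsP[P /andP[/and3P[/forall_inP ncP _ /forall_inP satP]]].
move=> /eqP PM.
have nPM x : x \in P -> neg x \notin M.
  move=> xP; apply/negP => nxM; have: x \in P :&: neg_set M.
    by rewrite inE xP mem_neg_set.
  by rewrite PM inE.
(* [P] decides the variables of [F]; elsewhere [M] decides, and variables in neither are set to
   true. *)
pose T := [set x | (x \in P) || (neg x \notin P) &&
                   ((x \in M) || (neg x \notin M) && x.2)].
exists T; split.
- move=> x; rewrite !inE negK /=.
  have := ncM x; have := ncP x; have := nPM x; have := nPM (neg x).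
  rewrite negK; case: (x \in P); case: (neg x \in P) => //=.
  + by move=> _ _ /(_ isT).
  + by case: (x \in M); case: (neg x \in M); case: x.2 => //= _ _ _ /(_ isT).
- apply/subsetP => x xM; rewrite inE xM /= andbT.
  case: (boolP (neg x \in P)) => [/nPM|]; last by rewrite orbT.
  by rewrite negK xM.
- apply/setP => C; rewrite !inE; apply/andP => -[CF /forall_inP H].
  by have /exists_inP[x xC xP] := satP C CF; have := H x xC; rewrite inE xP.
Qed.

Lemma culprit_of_total F L l T : total T -> L :|: [set l] \subset T ->
  culprit_set F L l (falsified F T).
Proof.
move=> totT /subsetP LT; apply/andP; split.
  by apply/subsetP => C; rewrite inE => /andP[].
(* A satisfying assignment has exactly the variables of its formula, and deleting clauses may lose
   some, so [T] is cut down to those of [G]. *)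
set G := F :\: _; apply/existsP; exists [set x in T | x.1 \in formula_vars G].
apply/andP; split; last first.
  apply/eqP/setP => x; rewrite !inE mem_neg_set; apply/negP.
  by case/andP => /andP[xT _] /LT; rewrite totT xT.
apply/and3P; split.
- by apply/forall_inP => x; rewrite !inE totT => /andP[->].
- apply/eqP/setP => v; apply/imsetP/idP => [[x]|vG].
    by rewrite inE => /andP[_ xG] ->.
  case: (boolP ((v, true) \in T)) => vT.
    by exists (v, true); rewrite ?inE ?vT.
  by exists (v, false); rewrite ?inE //= -[(v, false)]/(neg (v, true)) totT vT.
- apply/forall_inP => C CG; have := CG; rewrite !inE.
  case/andP=> + CF; rewrite CF /= => /forall_inPn[x xC].
  rewrite negbK => xT; apply/exists_inP; exists x; rewrite // inE xT /=.
  apply/imsetP; exists x => //; apply/bigcupP; by exists C.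
Qed.

(** Along a path the implied literals start in [B] and can leave it only through a boundary
    clause. *)
Lemma boundary_separator F L B x : non_contradictory B -> L \subset B ->
  x \notin B -> separator F (neg_set L) x (boundary F B).
Proof.
move=> /forall_inP ncB /subsetP LB xB; apply/andP; split.
  by apply/subsetP => C; rewrite !inE => /andP[/andP[]].
apply/asboolPn => -[e [w [/andP[/and3P[_ wF ww] _] eL wx]]].
move: eL; rewrite mem_neg_set => /LB neB; rewrite -{}wx in xB.
have step f : entry_clause f \in F :\: boundary F B -> neg f.1 \in B -> f.2 \in B.
  rewrite inE => /andP[+ fF] nfB; rewrite (mem_boundary B (erefl _) fF) nfB andbT.
  apply: contraR => -> /=; rewrite andbT; apply/negP => /ncB.
  by rewrite nfB.
elim: w e wF ww neB xB => [|f w IH] e /= /andP[eG wF].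
  by move=> _ /(step _ eG) ->.
case/andP=> /eqP ef fw /(step _ eG) e2B; apply: IH => //.
by rewrite -ef.
Qed.

(** * Implication chains and paths *)

Definition implies F := [rel x y | [set neg x; y] \in F].

Definition implied F L := [set y | [exists x in L, connect (implies F) x y]].

Lemma sub_implied F L : L \subset implied F L.
Proof.
by apply/subsetP => x xL; rewrite inE; apply/exists_inP; exists x.
Qed.

Lemma implied_step F L x y :
  x \in implied F L -> implies F x y -> y \in implied F L.
Proof.
rewrite !inE => /exists_inP[z zL zx] xy; apply/exists_inP; exists z => //.
exact: connect_trans zx (connect1 xy).
Qed.

Lemma implied_sub F L T : total T -> L \subset T -> falsified F T = set0 ->
  implied F L \subset T.
Proof.
move=> totT /subsetP LT F0; apply/subsetP => y; rewrite inE.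
case/exists_inP=> x /LT xT /connectP[p]; elim: p x xT => [|z p IH] x xT /=.
  by move=> _ ->.
case/andP=> xz; apply: IH; apply: contraT => zT.
have := mem_falsified T (erefl [set neg x; z]) xz.
by rewrite F0 inE totT xT zT.
Qed.

(** An implication leaving the closure cannot come from a surviving clause. *)
Lemma boundary_implied F S L : two_cnf F ->
  boundary F (implied (F :\: S) L) \subset S.
Proof.
move=> cnfF; apply/subsetP => C CB.
have CF : C \in F by move: CB; rewrite !inE => /andP[/andP[]].
have [a [b eC]] := cnfF C CF; move: CB; rewrite (mem_boundary _ eC CF).
case/and3P=> aA bA H; apply: contraT => CS.
have CG : C \in F :\: S by rewrite inE CS CF.
case/orP: H => /implied_step step.
  by rewrite -(negbTE bA); apply: step; rewrite /= negK -eC.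
by rewrite -(negbTE aA); apply: step; rewrite /= negK setUC -eC.
Qed.

(** Distinct literals alone do not give distinct clauses, since an implication and its
    contrapositive share a clause. Inside a total [T] no literal occurs together with its negation,
    which excludes this. *)
Lemma simple_path_of_path F T x p : total T -> {subset x :: p <= T} ->
  uniq (x :: p) -> p != [::] -> path (implies F) x p ->
  simple_path F (pairmap (fun y z => (neg y, z)) x p).
Proof.
move=> totT sT up p0 pp; apply/andP; split.
  apply/and3P; split; first by case: (p) p0.
    by elim: p x pp {p0 sT up} => //= y p IH x /andP[-> /IH].
  case: p {p0 sT up} pp => //= y p /andP[_].
  elim: p x y => //= z p IH x y /andP[_ pz]; rewrite negK eqxx /=; exact: IH.
elim: p x sT up {p0 pp} => //= y p IH x sT /andP[xp up].
rewrite IH ?andbT //; last by move=> z zp; apply: sT; rewrite inE zp orbT.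
have xT : x \in T by apply: sT; rewrite mem_head.
have nxp : neg x \notin y :: p.
  apply/negP => nxp; have : neg x \in T by apply: sT; rewrite inE nxp orbT.
  by rewrite totT xT.
(* If the first clause recurred, [neg x] would lie in a later entry, putting [x] or [neg x] among
   the later literals. *)
suff H e : e \in pairmap (fun y z => (neg y, z)) y p ->
    neg e.1 \in y :: p /\ e.2 \in y :: p.
  apply/mapP => -[e /H[e1 e2] ee].
  have : neg x \in entry_clause e by rewrite -ee !inE eqxx.
  case/set2P => ex; first by move: e1; rewrite -ex negK (negbTE xp).
  by move: e2; rewrite -ex (negbTE nxp).
elim: (p) (y) => //= z q IHq y'; rewrite inE => /orP[/eqP->|/IHq[e1 e2]].
  by rewrite /= negK !inE !eqxx orbT.
by rewrite !(in_cons y') e1 e2 !orbT.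
Qed.

Lemma separator_not_implied F S L T y : total T -> implied (F :\: S) L \subset T ->
  separator F (neg_set L) y S -> y \notin L -> y \notin implied (F :\: S) L.
Proof.
move=> totT /subsetP AT /andP[_ /asboolPn noP] yL; apply/negP.
rewrite inE => /exists_inP[x xL /connectP[p0 pp0 ey]].
case: (shortenP pp0) ey => p pp up _ ey.
(* The trivial chain yields no walk, walks being nonempty; [y \notin L] rules it out. *)
have pn0 : p != [::].
  by apply: contraNneq yL => p0'; rewrite ey p0'.
have sT : {subset x :: p <= T}.
  move=> z zp; apply: AT; rewrite inE; apply/exists_inP; exists x => //.
  exact: path_connect pp _ zp.
have := simple_path_of_path totT sT up pn0 pp.
case: p pn0 ey {pp up sT} => // z p _ /= ey sp; apply: noP.
exists (neg x, z), (pairmap (fun y z => (neg y, z)) z p); split => //.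
  by rewrite mem_neg_set negK.
by rewrite ey; elim: p (x) z {sp ey} => //= t p IH x' z; apply: IH z t.
Qed.

(** * Overriding an assignment *)

Definition override A P := [set x | (x \in A) || (x \in P) && (neg x \notin A)].

Lemma total_override A P : non_contradictory A -> total P -> total (override A P).
Proof.
move=> /forall_inP ncA totP x; have := ncA x; rewrite !inE negK totP.
by case: (x \in A); case: (neg x \in A); case: (x \in P) => // /(_ isT).
Qed.

Lemma override_submodular F A P T : two_cnf F -> total P -> total T ->
  A \subset T -> falsified F T = set0 ->
  #|falsified F (override A P)| + #|boundary F (A :&: P)| <=
  #|falsified F P| + #|boundary F A|.
Proof.
move=> cnfF totP totT /subsetP AT F0.
(* Each clause counts at most as often on the left as on the right. [T] excludes clauses with both
   negated literals in [A], where this could fail. *)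
have pointwise C : C \in F ->
    (((C \in falsified F (override A P)) || (C \in boundary F (A :&: P))) ==>
     ((C \in falsified F P) || (C \in boundary F A))) &&
    (((C \in falsified F (override A P)) && (C \in boundary F (A :&: P))) ==>
     ((C \in falsified F P) && (C \in boundary F A))).
  move=> CF; have [a [b eC]] := cnfF C CF.
  have := mem_falsified T eC CF; rewrite F0 inE.
  rewrite !(mem_falsified _ eC CF) !(mem_boundary _ eC CF) !inE !totP.
  have := AT a; have := AT b; have := AT (neg a); have := AT (neg b).
  rewrite !totT.
  case: (a \in T); case: (b \in T) => //;
  case: (a \in A); case: (neg a \in A); case: (b \in A); case: (neg b \in A);
  case: (a \in P); case: (b \in P) => //=;
  by do 5?[by move=> /(_ isT) | move=> _].
rewrite -[X in X <= _]cardsUI -[X in _ <= X]cardsUI.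
have sF C Q B : (C \in falsified F Q) || (C \in boundary F B) -> C \in F.
  by rewrite !inE => /orP[/andP[]|/andP[/andP[]]].
apply: leq_add; apply: subset_leq_card; apply/subsetP => C.
  rewrite !(in_setU C) => H; have /andP[/implyP + _] := pointwise C (sF _ _ _ H).
  exact.
rewrite !(in_setI C) => H.
have CF : C \in F by case/andP: H => H _; apply: (sF C (override A P) set0); rewrite H.
by have /andP[_ /implyP] := pointwise C CF; apply.
Qed.

End NeutralLiteral.

Theorem theorem3 (V : finType) (F : formula V) (L : {set lit V}) (l ls : lit V)
  (hI : instance F L l) (hN : neutral_literal F L l ls) :
  exists S' : formula V,
    culprit_set F (L :|: [set ls]) l S' /\
    (forall S : formula V, smallest_culprit_set F L l S -> #|S'| <= #|S|).
Proof.
have [[cnfF ncL _ lL] [[_ ncM swM lM] eqsep]] := (hI, hN).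
set M := L :|: [set ls] in ncM swM lM eqsep *.
have [S [/andP[_ swS] minS]] := smallest_culprit_set_exists F L l.
have LM : L \subset M by rewrite subsetUl.
have ncLl : non_contradictory (L :|: [set l]).
  move: lL; rewrite mem_vars negb_or => /andP[lL nlL].
  apply/forall_inP => x /setUP[xL|/set1P ->]; rewrite !inE negb_or.
    rewrite (forall_inP ncL) //=; apply: contraNneq nlL => <-.
    by rewrite negK.
  by rewrite nlL; apply/eqP => /(congr1 snd) /=; case: (l.2).
have [P [totP LlP FP]] := total_of_SWRT ncLl swS.
have [T [totT MT FT]] := total_of_SWRT ncM swM.
have [[SC sepSC cardSC] _] := SepSizeP F (neg_set M) (neg l).
have [_ minSep] := SepSizeP F (neg_set L) (neg l).
pose A := implied (F :\: SC) M.
have AT : A \subset T.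
  apply: implied_sub => //; apply/eqP; rewrite -subset0 -FT.
  by apply/subsetP => C; rewrite !inE => /andP[/andP[_ ->] ->].
have ncA : non_contradictory A.
  apply/forall_inP => x /(subsetP AT) xT; apply/negP => /(subsetP AT).
  by rewrite totT xT.
have nlA : neg l \notin A.
  apply: (separator_not_implied totT AT sepSC).
  by move: lM; rewrite mem_vars negb_or => /andP[].
have boundaryA : #|boundary F A| <= #|boundary F (A :&: P)|.
  apply: leq_trans (subset_leq_card (boundary_implied _ _ cnfF)) _.
  (* Neutrality enters here: [A :&: P] contains [L] and avoids [neg l], so its boundary is a
     separator for [neg_set L], of size at least [#|SC|]. *)
  rewrite cardSC -eqsep; apply/minSep/boundary_separator.
  - apply/forall_inP => x /setIP[xA _]; rewrite inE negb_and.
    by rewrite (forall_inP ncA).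
  - rewrite subsetI (subset_trans LM (sub_implied _ _)) /=.
    exact: subset_trans (subsetUl _ _) LlP.
  - by rewrite inE negb_and nlA.
have falsP : falsified F P \subset S.
  apply/subsetP => C; rewrite inE => /andP[CF CP]; apply: contraT => CS.
  by have : C \in falsified (F :\: S) P; [rewrite !inE CS CF CP | rewrite FP inE].
exists (falsified F (override A P)); split.
  apply: culprit_of_total; first exact: total_override.
  apply/subsetP => x /setUP[xM|/set1P ->]; rewrite inE.
    by rewrite (subsetP (sub_implied _ _)).
  (* [l] survives the override, being in [P] with [neg l] outside [A]. *)
  by rewrite nlA (subsetP LlP) ?orbT // !inE eqxx orbT.
move=> S0 [culS0 _]; apply: leq_trans (minS _ culS0).
apply: leq_trans (subset_leq_card falsP).
have := override_submodular cnfF totP totT AT FT.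
by move=> /leq_trans/(_ (leq_add (leqnn _) boundaryA)); rewrite leq_add2r.
Qed.
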